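(* Let $A,G,Q,\Gamma\in\mathbb{R}^{n\times n}$, $B\in\mathbb{R}^{n\times m}$, $R\in\mathbb{R}^{m\times m}$ with $Q,R$ symmetric, let $0<\gamma<1$ and $Q_\Gamma=\Gamma^{T}Q\Gamma-Q\Gamma-\Gamma^{T}Q$. Suppose Assumptions 1 and 2 (stated in the context) hold, and that in addition either Assumption 3 or Assumption 4 (both stated in the context) is satisfied. Let $P$ be the stabilizing solution of $$P=\gamma A^{T}PA-\gamma^{2}A^{T}PB(R+\gamma B^{T}PB)^{-1}B^{T}PA+Q,$$ $K=\gamma(R+\gamma B^{T}PB)^{-1}B^{T}PA$, let $\Pi$ be the stabilizing solution of $$\Pi=\gamma(A+G)^{T}\Pi(A+G)-\gamma^{2}(A+G)^{T}\Pi B(R+\gamma B^{T}\Pi B)^{-1}B^{T}\Pi(A+G)+Q+Q_\Gamma,$$ and $\bar K=\gamma(R+\gamma B^{T}\Pi B)^{-1}B^{T}\Pi(A+G)-K$. Let $\bar K_0\in\mathbb{R}^{m\times n}$ be such that $\bar K_0+K$ is a $\gamma$-stabilizer of $(A+G,B)$, i.e. $\sqrt{\gamma}\,(A+G-BK-B\bar K_0)$ is Schur. For $k=0,1,2,\dots$ let $\Pi_k\in\mathbb{R}^{n\times n}$ (symmetric) and $\bar K_{k+1}\in\mathbb{R}^{m\times n}$ be solutions of $$\Pi_k=\gamma\bar A_k^{T}\Pi_k\bar A_k+(K+\bar K_k)^{T}R(K+\bar K_k)+Q+Q_\Gamma,\qquad \bar A_k:=A+G-BK-B\bar K_k,$$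 $$\bar K_{k+1}=\gamma(R+\gamma B^{T}\Pi_kB)^{-1}B^{T}\Pi_k(A+G)-K .$$ Then: (a) for all $k\ge0$, $\sqrt{\gamma}\bar A_k$ is Schur; (b) $\Pi_k\ge\Pi_{k+1}\ge\Pi$ for all $k\ge0$; (c) $\lim_{k\to\infty}\Pi_k=\Pi$ and $\lim_{k\to\infty}\bar K_k=\bar K$.
   Context: Setting. There are $N$ agents with states $x_{ik}\in\mathbb{R}^n$ and inputs $u_{ik}\in\mathbb{R}^m$ ($1\le i\le N$, time $k\ge0$) obeying $x_{i(k+1)}=Ax_{ik}+Gx_k^{(N)}+Bu_{ik}+Dw_{ik}$, where $x_k^{(N)}=\frac1N\sum_{i=1}^N x_{ik}$ and $w_{ik}$ are independent white noises with zero mean and variance $\sigma^2$. Assumption 1. The initial states $\{x_{i0}\}_{i=1}^N$ are mutually independent and independent of the noises $\{w_i\}_{i=1}^N$; they have the same mathematical expectation and finite second moments. Assumption 2. $(A,B)$ and $(A+G,B)$ are $\gamma$-stabilizable, i.e. there are $F_1,F_2\in\mathbb{R}^{m\times n}$ such that $\sqrt\gamma(A-BF_1)$ and $\sqrt\gamma(A+G-BF_2)$ are Schur. Assumption 3. $Q\ge0$, $R>0$, the pair $(\sqrt{\gamma}A,\sqrt{Q})$ is detectable, and the pair $(\sqrt{\gamma}(A+G),\sqrt{Q}(I-\Gamma))$ is detectable. (Here $(M,C)$ is detectable if there is a matrix $L$ such that $M+LC$ is Schur.) Assumption 4. There exist symmetric $\tilde P,\tilde\Pi\in\mathbb{R}^{n\times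 n}$ with $\mathcal{H}(\tilde P)>0$ and $\bar{\mathcal{H}}(\tilde\Pi)>0$, where $$\mathcal{H}(P)=\begin{bmatrix}\gamma A^{T}PA-P+Q&\gamma A^{T}PB\\ \gamma B^{T}PA&R+\gamma B^{T}PB\end{bmatrix},$$ $$\bar{\mathcal{H}}(\Pi)=\begin{bmatrix}\gamma(A+G)^{T}\Pi(A+G)-\Pi+Q+Q_\Gamma&\gamma(A+G)^{T}\Pi B\\ \gamma B^{T}\Pi(A+G)&R+\gamma B^{T}\Pi B\end{bmatrix}.$$ (Under Assumption 4, $Q$ and $R$ may be indefinite.) Conventions. A square matrix is Schur if all its eigenvalues have modulus $<1$. $\ge$ and $>$ between symmetric matrices denote the Loewner order. $\sqrt{Q}$ is the positive semidefinite square root. A stabilizing solution of the Riccati equation for $P$ (resp. $\Pi$) is a symmetric solution with $R+\gamma B^TPB$ (resp. $R+\gamma B^T\Pi B$) invertible for which $\sqrt{\gamma}(A-BK)$ (resp. $\sqrt\gamma(A+G-BK-B\bar K)$) is Schur. That $\bar K_{k+1}$ solves its equation includes that the inverse in it exists. *)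

(* Defs.v *)
From HB Require Import structures.
From mathcomp Require Import all_boot all_order all_algebra.
From mathcomp Require Import all_classical all_reals all_analysis.
From mathcomp.real_closed Require Import complex.
Set Implicit Arguments.
Unset Strict Implicit.
Unset Printing Implicit Defensive.
Import Order.TTheory GRing.Theory Num.Theory.
Import numFieldNormedType.Exports.
Local Open Scope classical_set_scope.
Local Open Scope ring_scope.

Section Matrices.
Variable R : realType.

Definition posdef n (M : 'M[R]_n) : Prop :=
  M^T = M /\ forall v : 'cV[R]_n, v != 0 -> 0 < (v^T *m M *m v) 0 0.

Definition possemidef n (M : 'M[R]_n) : Prop :=
  M^T = M /\ forall v : 'cV[R]_n, 0 <= (v^T *m M *m v) 0 0.

Definition loewner_le n (M1 M2 : 'M[R]_n) : Prop := possemidef (M2 - M1).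

(* Meaningful for positive semidefinite [M], where the square root exists and
   is unique; the default value is 0 when there is none. *)
Definition psd_sqrt n (M : 'M[R]_n) : 'M[R]_n :=
  xget 0 [set S | possemidef S /\ S *m S = M].

(* The eigenvalues are the complex ones; [`|z|] lives in [R[i]], whose partial
   order restricts to the usual order on real elements. *)
Definition schur n (M : 'M[R]_n) : Prop :=
  forall z : R[i], eigenvalue (map_mx (real_complex R) M) z -> `|z| < 1.

Definition stabilizer n m (gamma : R) (A : 'M[R]_n) (B : 'M[R]_(n, m))
    (F : 'M[R]_(m, n)) : Prop :=
  schur (Num.sqrt gamma *: (A - B *m F)).

Definition stabilizable n m (gamma : R) (A : 'M[R]_n) (B : 'M[R]_(n, m)) :
    Prop :=
  exists F : 'M[R]_(m, n), stabilizer gamma A B F.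

Definition detectable n q (M : 'M[R]_n) (C : 'M[R]_(q, n)) : Prop :=
  exists L : 'M[R]_(n, q), schur (M + L *m C).

Definition weight n m (gamma : R) (B : 'M[R]_(n, m)) (Rc : 'M[R]_m)
    (P : 'M[R]_n) : 'M[R]_m :=
  Rc + gamma *: (B^T *m P *m B).

Definition riccati_gain n m (gamma : R) (A : 'M[R]_n) (B : 'M[R]_(n, m))
    (Rc : 'M[R]_m) (P : 'M[R]_n) : 'M[R]_(m, n) :=
  gamma *: (invmx (weight gamma B Rc P) *m B^T *m P *m A).

(* The stability of the closed loop is not part of this predicate. *)
Definition riccati_solution n m (gamma : R) (A : 'M[R]_n) (B : 'M[R]_(n, m))
    (Q : 'M[R]_n) (Rc : 'M[R]_m) (P : 'M[R]_n) : Prop :=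
  [/\ P^T = P,
      weight gamma B Rc P \in unitmx
    & P = gamma *: (A^T *m P *m A)
          - gamma ^+ 2 *: (A^T *m P *m B *m invmx (weight gamma B Rc P)
                           *m B^T *m P *m A)
          + Q].

Definition riccati_block n m (gamma : R) (A : 'M[R]_n) (B : 'M[R]_(n, m))
    (Q : 'M[R]_n) (Rc : 'M[R]_m) (P : 'M[R]_n) : 'M[R]_(n + m) :=
  block_mx (gamma *: (A^T *m P *m A) - P + Q) (gamma *: (A^T *m P *m B))
           (gamma *: (B^T *m P *m A))         (weight gamma B Rc P).

Definition Qshift n (Q Gam : 'M[R]_n) : 'M[R]_n :=
  Gam^T *m Q *m Gam - Q *m Gam - Gam^T *m Q.

End Matrices.

Section Probability.
Context (R : realType) (d : measure_display) (Omega : measurableType d).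
Variable Pr : probability Omega R.

Definition coord n (X : Omega -> 'cV[R]_n) (a : 'I_n) : Omega -> R :=
  fun omega => X omega a 0.

(* The sigma-algebra generated by all coordinates of all the vectors [X j]. *)
Definition sigma_of (J : Type) n (X : J -> Omega -> 'cV[R]_n) :
    set (set Omega) :=
  <<s \bigcup_(ja in [set: J * 'I_n])
        preimage_set_system setT (coord (X ja.1) ja.2)
          (measurable : set (set R)) >>.

Definition mutually_independent (J : eqType) n (X : J -> Omega -> 'cV[R]_n) :
    Prop :=
  forall (s : seq J) (E : J -> set Omega), uniq s ->
    (forall j, j \in s -> sigma_of (fun _ : unit => X j) (E j)) ->
    Pr (\bigcap_(j in [set` s]) E j) = (\prod_(j <- s) Pr (E j))%E.

Definition independent_families (I J : Type) n q
    (X : I -> Omega -> 'cV[R]_n) (Y : J -> Omega -> 'cV[R]_q) : Prop :=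
  forall E F : set Omega, sigma_of X E -> sigma_of Y F ->
    Pr (E `&` F) = (Pr E * Pr F)%E.

(* The noises take values in [R^q] with covariance [sigma^2 I]; [q = 1] is the
   scalar case.  [Lfun Pr 2%:E] includes measurability. *)
Definition white_noises N q (sigma : R) (w : 'I_N -> nat -> Omega -> 'cV[R]_q) :
    Prop :=
  [/\ forall i k a, coord (w i k) a \in Lfun Pr 2%:E,
      mutually_independent (fun ik : 'I_N * nat => w ik.1 ik.2),
      forall i k a, 'E_Pr[coord (w i k) a]%E = 0%:E
    & forall i k a b,
        covariance Pr (coord (w i k) a) (coord (w i k) b)
        = (if a == b then sigma ^+ 2 else 0)%:E].

Definition initial_states N n q (x0 : 'I_N -> Omega -> 'cV[R]_n)
    (w : 'I_N -> nat -> Omega -> 'cV[R]_q) : Prop :=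
  [/\ forall i a, coord (x0 i) a \in Lfun Pr 2%:E,
      mutually_independent x0,
      independent_families x0 (fun ik : 'I_N * nat => w ik.1 ik.2)
    & forall i j a, 'E_Pr[coord (x0 i) a]%E
                    = 'E_Pr[coord (x0 j) a]%E].

Definition mean_field_dynamics N n m q (A G : 'M[R]_n) (B : 'M[R]_(n, m))
    (D : 'M[R]_(n, q)) (x : 'I_N -> nat -> Omega -> 'cV[R]_n)
    (u : 'I_N -> nat -> Omega -> 'cV[R]_m)
    (w : 'I_N -> nat -> Omega -> 'cV[R]_q) : Prop :=
  forall i k omega,
    x i k.+1 omega = A *m x i k omega
                     + G *m (N%:R^-1 *: \sum_(j < N) x j k omega)
                     + B *m u i k omega + D *m w i k omega.

End Probability.

(* Main.v *)
Require Import Defs.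
From HB Require Import structures.
From mathcomp Require Import all_boot all_order all_algebra.
From mathcomp Require Import all_classical all_reals all_analysis.
From mathcomp Require Import ring lra.
From mathcomp.real_closed Require Import complex.
Import Order.TTheory GRing.Theory Num.Theory.
Import numFieldNormedType.Exports.
Import Normc.
Local Open Scope classical_set_scope.
Local Open Scope ring_scope.
Set Implicit Arguments.
Unset Strict Implicit.

(* After replacing [A + G] and [B] by their multiples by [sqrt gamma], written
   [A] and [B] below, this is Kleinman-Hewer policy iteration for a possibly
   indefinite cost.  If [W P = R + B^T P B] and
   [W P * F' = B^T P A], completing the square shows that the cost operator
   [T_F P = (A - B F)^T P (A - B F) + F^T R F + S] satisfies
   [T_F P = T_F' P + (F - F')^T W P (F - F')].  Comparing two costs then reduces
   to: if [M] is Schur and [X - M^T X M >= 0], then [X >= 0].  The weight [W Pi]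
   is positive definite: [Pi >= 0] if [Q >= 0], and [Pi >= Pit] if the block
   matrix of [Pit] is positive definite.  An eigenvector of the improved closed
   loop for an eigenvalue of modulus at least 1 is annihilated by the squared
   terms of the identity for [Pi_k - Pi], so it is also an eigenvector of the
   Schur matrix [A - B F*], which is impossible.  Finally [Pi_k] decreases to a
   solution of the Riccati equation above [Pi], which one more comparison along
   [F*] bounds by [Pi]. *)

(** * Entrywise limits and continuity of the matrix operations *)

Section MatrixLimits.
Variable R : realType.

Lemma cvg_mxP m n (M_ : nat -> 'M[R]_(m, n)) (M : 'M[R]_(m, n)) :
  M_ @ \oo --> M <-> forall i j, (fun k => M_ k i j) @ \oo --> M i j.
Proof.
split=> [MM i j|MM].
  exact: (cvg_comp _ _ MM (@coord_continuous R m n i j M)).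
apply/cvgrPdist_lt => e e0; have e20 : 0 < e / 2 by rewrite divr_gt0.
(* The norm is the maximum over finitely many entries, so the eventual bounds on the entries hold
   simultaneously. *)
suff : \forall k \near \oo, forall ij : 'I_m * 'I_n,
    `|M ij.1 ij.2 - M_ k ij.1 ij.2| < e.
  apply: filterS => k Mk; rewrite [ltLHS]mx_normrE.
  apply/bigmax_ltP; split=> //.
  by move=> ij _; rewrite !mxE; exact: Mk.
apply: filter_forall => -[i j] /=.
by have /cvgrPdist_lt := MM i j; exact.
Qed.

Lemma cvg_mulmx m n p (M_ : nat -> 'M[R]_(m, n)) (M : 'M[R]_(m, n))
    (N_ : nat -> 'M[R]_(n, p)) (N : 'M[R]_(n, p)) :
  M_ @ \oo --> M -> N_ @ \oo --> N ->
  (fun k => M_ k *m N_ k) @ \oo --> M *m N.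
Proof.
move=> /cvg_mxP MM /cvg_mxP NN; apply/cvg_mxP => i j.
rewrite mxE; under eq_cvg do rewrite mxE.
by apply: (cvg_big (@add_continuous R)) => l _; apply: cvgM.
Qed.

Lemma cvg_trmx m n (M_ : nat -> 'M[R]_(m, n)) (M : 'M[R]_(m, n)) :
  M_ @ \oo --> M -> (fun k => (M_ k)^T) @ \oo --> M^T.
Proof.
move=> /cvg_mxP MM; apply/cvg_mxP => i j.
by rewrite mxE; under eq_cvg do rewrite mxE; exact: MM.
Qed.

Lemma cvg_det n (M_ : nat -> 'M[R]_n) (M : 'M[R]_n) :
  M_ @ \oo --> M -> (fun k => \det (M_ k)) @ \oo --> \det M.
Proof.
move=> /cvg_mxP MM; apply: (cvg_big (@add_continuous R)) => s _.
apply: cvgMl_tmp; apply: (cvg_big (@mul_continuous R)) => i _; exact: MM.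
Qed.

(** On units [invmx] is the adjugate over the determinant, and cofactors are again determinants.
    Elsewhere [invmx] returns its argument, so invertibility is assumed along the whole sequence. *)
Lemma cvg_invmx n (M_ : nat -> 'M[R]_n) (M : 'M[R]_n) :
  (forall k, M_ k \in unitmx) -> M \in unitmx ->
  M_ @ \oo --> M -> (fun k => invmx (M_ k)) @ \oo --> invmx M.
Proof.
move=> Mu_ Mu MM; rewrite /invmx Mu; under eq_fun do rewrite Mu_.
apply: cvgZ.
  by apply: cvgV; [rewrite -unitfE -unitmxE|exact: cvg_det].
apply/cvg_mxP => i j; rewrite mxE; under eq_cvg do rewrite mxE.
apply: cvgMl_tmp; apply: cvg_det; apply/cvg_mxP => k l.
rewrite !mxE; under eq_cvg do rewrite !mxE.
move/cvg_mxP : MM; exact.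
Qed.

End MatrixLimits.

(** * Powers of a Schur matrix tend to zero *)

Section SchurPowers.
Variable R : realType.
Local Notation C := R[i].

Lemma contraction_cvg0 (c : R) (r e : nat -> R) : 0 <= c < 1 ->
  (forall k, 0 <= r k) -> (forall k, r k.+1 <= c * r k + e k) ->
  e @ \oo --> 0 -> r @ \oo --> 0.
Proof.
move=> /andP[c0 c1] r0 rS ecvg.
have c1' : 0 < 1 - c by rewrite subr_gt0.
apply/cvgr0Pnorm_lt => eps eps0.
(* With this threshold [d] the map [t -> c * t + d] fixes [eps / 2], which gives the geometric bound
   on the tail. *)
have d0 : 0 < eps / 2 * (1 - c) by rewrite mulr_gt0// divr_gt0.
have /cvgr0Pnorm_lt /(_ _ d0) [N _ eN] := ecvg.
have bnd j : r (N + j)%N <= c ^+ j * r N + eps / 2.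
  elim: j => [|j IH].
    by rewrite addn0 expr0 mul1r lerDl ltW// divr_gt0.
  rewrite addnS; apply: (le_trans (rS _)).
  have /ltW := eN _ (leq_addr j N); move=> /(le_trans (ler_norm _)) ej.
  apply: (le_trans (lerD (ler_wpM2l c0 IH) ej)).
  rewrite exprS mulrDr mulrA -addrA lerD2l.
  by rewrite mulrBr mulr1 [c * _]mulrC addrC subrK.
have gcvg : (fun j => c ^+ j * r N) @ \oo --> 0.
  rewrite -[0 in X in _ --> X](mul0r (r N)).
  by apply: cvgMr_tmp; apply: cvg_expr; rewrite ger0_norm.
have e20 : 0 < eps / 2 by rewrite divr_gt0.
have /cvgr0Pnorm_lt /(_ _ e20) [N' _ gN'] := gcvg.
exists (N + N')%N => // k /= Nk.
have Nle : (N <= k)%N := leq_trans (leq_addr _ _) Nk.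
rewrite ger0_norm// -(subnKC Nle).
apply: (le_lt_trans (bnd _)); rewrite [ltRHS]splitr ltrD2r.
apply: le_lt_trans (ler_norm _) _; apply: gN' => /=.
by rewrite leq_subRL.
Qed.

(** [normc] takes values in [R], so complex matrices are handled through real limits. *)
Definition null_mx_seq {m n} (W : nat -> 'M[C]_(m, n)) : Prop :=
  forall i j, (fun k => normc (W k i j)) @ \oo --> 0.

(** Each entry obeys the recursion [W k.+1 = z *: W k + error] with a vanishing error, a contraction
    in modulus. *)
Lemma null_mx_seq_shift m n (z : C) (W : nat -> 'M[C]_(m, n)) : normc z < 1 ->
  null_mx_seq (fun k => W k.+1 - z *: W k) -> null_mx_seq W.
Proof.
move=> z1 Wz i j; apply: (@contraction_cvg0 (normc z) _ _ _ _ _ (Wz i j)).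
- by rewrite z1 andbT; case: (z) => a b; rewrite sqrtr_ge0.
- by move=> k; case: (W k i j) => a b; rewrite sqrtr_ge0.
move=> k; rewrite !mxE -normcM; apply: le_trans (le_normcD _ _).
by rewrite [_ + (_ - _)]addrC subrK.
Qed.

(** Over the complex numbers the characteristic polynomial splits. By Cayley-Hamilton the full
    product of linear factors vanishes at [M]; the factors are then removed one at a time, without
    any Jordan form. *)
Lemma null_mx_seq_exp n (M : 'M[C]_n.+1) :
  (forall z, eigenvalue M z -> normc z < 1) -> null_mx_seq (fun k => M ^+ k).
Proof.
move=> Mz.
have [s Es] := closed_field_poly_normal (char_poly M).
rewrite (monicP (char_poly_monic M)) scale1r in Es.
have {}Mz z : z \in s -> normc z < 1.
  by move=> zs; apply: Mz; rewrite eigenvalue_root_char Es root_prod_XsubC.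
have peel p : null_mx_seq (fun k =>
    horner_mx M (p * \prod_(z <- s) ('X - z%:P)) * M ^+ k) ->
  null_mx_seq (fun k => horner_mx M p * M ^+ k); last first.
  suff : null_mx_seq (fun k => horner_mx M 1 * M ^+ k).
    by under eq_fun do rewrite rmorph1 mul1r.
  apply: peel; rewrite mul1r -Es Cayley_Hamilton => i j.
  under eq_fun do rewrite mul0r mxE normc0.
  exact: cvg_cst.
(* [p] is generalized so that it can absorb the factor ['X - z%:P]; multiplying by that factor at
   [M] amounts to passing from [W k] to [W k.+1 - z *: W k]. *)
elim: s {Es} Mz p => [|z s IH] Mz p.
  by rewrite big_nil mulr1.
rewrite big_cons mulrA => /IH{}IH.
have {}IH : null_mx_seq (fun k => horner_mx M (p * ('X - z%:P)) * M ^+ k).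
  by apply: IH => y ys; apply: Mz; rewrite inE ys orbT.
apply: (@null_mx_seq_shift _ _ z); first by apply: Mz; rewrite mem_head.
move: IH; congr (null_mx_seq _); apply/funext => k.
rewrite rmorphM rmorphB /= horner_mx_X horner_mx_C mulrBr mulrBl exprS mulrA.
by rewrite -scalemx1 -!mulmxE -scalemxAr mulmx1 scalemxAl.
Qed.

Lemma normc_real (a : R) : normc (real_complex R a) = `|a|.
Proof. by rewrite /= expr0n /= addr0 sqrtr_sqr. Qed.

Lemma normc_lt1 (z : C) : (`|z| < 1) = (normc z < 1).
Proof. by rewrite -(ltcR (normc z) 1). Qed.

Lemma schur_pow_cvg0 n (M : 'M[R]_n) : schur M ->
  (fun k => M ^+ k : 'M[R]_n) @ \oo --> (0 : 'M[R]_n).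
Proof.
case: n M => [|n] M Ms; apply/cvg_mxP => i j; first by case: i.
rewrite mxE; apply/cvgr0Pnorm_lt => e e0.
have := @null_mx_seq_exp n (map_mx (real_complex R) M).
move=> /(_ _ i j) /cvgr0Pnorm_lt /(_ _ e0) H; apply: filterS (H _).
  by move=> k; rewrite -rmorphXn /= mxE normc_real normr_id.
by move=> z /Ms; rewrite normc_lt1.
Qed.

End SchurPowers.

(** * Quadratic forms, the Loewner order and Lyapunov comparison *)

Section QuadraticForms.
Variable R : realType.

Definition qform n (X : 'M[R]_n) (v : 'cV[R]_n) : R := (v^T *m X *m v) 0 0.

Lemma qformD n (X Y : 'M[R]_n) v : qform (X + Y) v = qform X v + qform Y v.
Proof. by rewrite /qform mulmxDr mulmxDl mxE. Qed.

Lemma qformN n (X : 'M[R]_n) v : qform (- X) v = - qform X v.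
Proof. by rewrite /qform mulmxN mulNmx mxE. Qed.

Lemma qformB n (X Y : 'M[R]_n) v : qform (X - Y) v = qform X v - qform Y v.
Proof. by rewrite qformD qformN. Qed.

Lemma qform_congr n m (X : 'M[R]_m) (M : 'M[R]_(m, n)) v :
  qform (M^T *m X *m M) v = qform X (M *m v).
Proof. by rewrite /qform trmx_mul !mulmxA. Qed.

Lemma bilin_sym n (X : 'M[R]_n) (v w : 'cV[R]_n) : X^T = X ->
  (v^T *m X *m w) 0 0 = (w^T *m X *m v) 0 0.
Proof.
move=> Xs; rewrite -[in LHS](trmxK (v^T *m X *m w)) [in LHS]mxE.
by rewrite !trmx_mul trmxK Xs mulmxA.
Qed.

Lemma qform_add n (X : 'M[R]_n) (v w : 'cV[R]_n) : X^T = X ->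
  qform X (v + w) = qform X v + qform X w + 2 * (v^T *m X *m w) 0 0.
Proof.
move=> Xs; have addE (Y Z : 'M[R]_1) : (Y + Z) 0 0 = Y 0 0 + Z 0 0 by rewrite mxE.
rewrite /qform [(v + w)^T]linearD /= !mulmxDl !mulmxDr !addE.
by rewrite (bilin_sym w v Xs); ring.
Qed.

Lemma qformZ n (X : 'M[R]_n) a (v : 'cV[R]_n) :
  qform X (a *: v) = a ^+ 2 * qform X v.
Proof. by rewrite /qform [(a *: v)^T]linearZ /= -!scalemxAl -scalemxAr scalerA mxE. Qed.

(** Polarization; it transfers equalities and limits from quadratic forms to entries. *)
Lemma entry_qform n (X : 'M[R]_n) i j : X^T = X ->
  X i j = 2^-1 * (qform X (delta_mx i 0 + delta_mx j 0)
                  - qform X (delta_mx i 0) - qform X (delta_mx j 0)).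
Proof.
move=> Xs; rewrite qform_add // trmx_delta -rowE -colE !mxE.
by rewrite addrAC addrAC -addrA; field.
Qed.

Lemma possemidefD n (X Y : 'M[R]_n) :
  possemidef X -> possemidef Y -> possemidef (X + Y).
Proof.
move=> [Xs X0] [Ys Y0]; split=> [|v]; first by rewrite linearD /= Xs Ys.
by rewrite -/(qform _ v) qformD addr_ge0 // ?X0 ?Y0.
Qed.

Lemma possemidef_congr n m (X : 'M[R]_m) (M : 'M[R]_(m, n)) :
  possemidef X -> possemidef (M^T *m X *m M).
Proof.
move=> [Xs X0]; split=> [|v]; first by rewrite !trmx_mul trmxK Xs mulmxA.
by rewrite -/(qform _ v) qform_congr; exact: X0.
Qed.

Lemma posdefW n (X : 'M[R]_n) : posdef X -> possemidef X.
Proof.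
move=> [Xs X0]; split=> // v; have [->|/X0/ltW //] := eqVneq v 0.
by rewrite mulmx0 mxE.
Qed.

Lemma posdefD n (X Y : 'M[R]_n) :
  posdef X -> possemidef Y -> posdef (X + Y).
Proof.
move=> [Xs X0] [Ys Y0]; split=> [|v v0]; first by rewrite linearD /= Xs Ys.
by rewrite -/(qform _ v) qformD ltr_wpDr // ?X0 ?Y0.
Qed.

Lemma posdef_unitmx n (X : 'M[R]_n) : posdef X -> X \in unitmx.
Proof.
move=> [_ X0]; rewrite -row_free_unit -kermx_eq0; apply/eqP/row_matrixP => i.
rewrite row0; apply/eqP/negP => /negP v0; set v := row i _ in v0.
have vX : v *m X = 0 by apply/sub_kermxP; exact: row_sub.
have : v^T != 0 by rewrite -(inj_eq trmx_inj) trmxK trmx0.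
by move=> /X0; rewrite trmxK vX mul0mx mxE ltxx.
Qed.

Lemma loewner_le_anti n (X Y : 'M[R]_n) :
  loewner_le X Y -> loewner_le Y X -> X = Y.
Proof.
move=> [XYs XY0] [YXs YX0]; apply/eqP; rewrite -subr_eq0; apply/eqP.
have q0 v : qform (X - Y) v = 0.
  apply/eqP; rewrite eq_le YX0 andbT -oppr_ge0 -qformN opprB; exact: XY0.
by apply/matrixP => i j; rewrite entry_qform // !q0 !subr0 mulr0 mxE.
Qed.

(** The form of [X] does not increase along the orbit [M ^+ k *m v], and this orbit tends to 0;
    hence its initial value is at least 0. *)
Lemma schur_lyapunov n (M X : 'M[R]_n) : schur M -> X^T = X ->
  possemidef (X - M^T *m X *m M) -> possemidef X.
Proof.
move=> Ms Xs [_ XM]; split => // v; rewrite -/(qform X v).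
have mono k : qform X (M ^+ k *m v) <= qform X v.
  elim: k => [|k]; first by rewrite expr0 mul1mx.
  apply: le_trans; rewrite exprS -mulmxE -mulmxA -subr_ge0.
  rewrite -(qform_congr X M) -qformB; exact: XM.
have lim0 : (fun k => qform X (M ^+ k *m v)) @ \oo --> 0.
  have Mv : (fun k => M ^+ k *m v) @ \oo --> 0 *m v.
    by apply: cvg_mulmx; [exact: schur_pow_cvg0|exact: cvg_cst].
  have Xc : (fun=> X) @ \oo --> X by exact: cvg_cst.
  have := cvg_mulmx (cvg_mulmx (cvg_trmx Mv) Xc) Mv.
  by rewrite mul0mx mulmx0 => /cvg_mxP /(_ 0 0); rewrite mxE.
rewrite -(cvg_lim _ lim0) //.
apply: limr_le; first by apply/cvg_ex; exists 0.
by near=> k; exact: mono.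
Unshelve. all: by end_near. Qed.

End QuadraticForms.

(** * Complex eigenvectors in real coordinates and a Schur criterion *)

Section RealEigenvectors.
Variable R : realType.
Local Notation C := R[i].
Local Notation cplx := (map_mx (real_complex R)).

(* [x] and [y] are the real and imaginary parts of a complex right
   eigenvector. *)
Definition eigenpair n (M : 'M[R]_n) (z : C) (x y : 'cV[R]_n) : Prop :=
  [/\ (x != 0) || (y != 0),
      M *m x = complex.Re z *: x - complex.Im z *: y
    & M *m y = complex.Im z *: x + complex.Re z *: y].

Lemma eigenvalue_trmx n (M : 'M[C]_n) z : eigenvalue M^T z = eigenvalue M z.
Proof.
rewrite !eigenvalue_root_char; congr (root _ z).
by rewrite /char_poly /char_poly_mx -map_trmx -[in LHS](tr_scalar_mx n 'X) -linearB /= det_tr.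
Qed.

(** [eigenvalue] refers to row vectors, whereas closed loops act on columns; a matrix and its
    transpose share their characteristic polynomial. *)
Lemma eigenvalue_colP n (M : 'M[C]_n) z :
  reflect (exists2 u : 'cV[C]_n, M *m u = z *: u & u != 0) (eigenvalue M z).
Proof.
rewrite -eigenvalue_trmx; apply: (iffP eigenvalueP) => -[u uM u0].
  exists u^T; last by rewrite -(inj_eq trmx_inj) trmxK trmx0.
  by rewrite -[M]trmxK -trmx_mul uM linearZ.
exists u^T; last by rewrite -(inj_eq trmx_inj) trmxK trmx0.
by rewrite -trmx_mul uM linearZ.
Qed.

Lemma eigenvalue_eigenpair n (M : 'M[R]_n) (z : C) :
  eigenvalue (cplx M) z <-> exists x y, eigenpair M z x y.
Proof.
pose Re := @complex.Re R; pose Im := @complex.Im R.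
have ReD u v : Re (u + v) = Re u + Re v by case: u v => [? ?] [? ?].
have ImD u v : Im (u + v) = Im u + Im v by case: u v => [? ?] [? ?].
have ReM u v : Re (u * v) = Re u * Re v - Im u * Im v by case: u v => [? ?] [? ?].
have ImM u v : Im (u * v) = Im u * Re v + Re u * Im v.
  by case: u v => [? ?] [? ?]; rewrite /= addrC.
have ReIm u v : Re u = Re v -> Im u = Im v -> u = v.
  by case: u v => [? ?] [? ?] /= -> ->.
have ReS (u : 'cV[C]_n) i :
    Re ((cplx M *m u) i 0) = (M *m map_mx Re u) i 0.
  rewrite !mxE (big_morph Re ReD (erefl (Re 0))); apply: eq_bigr => j _.
  by rewrite ReM !mxE /= mul0r subr0.
have ImS (u : 'cV[C]_n) i :
    Im ((cplx M *m u) i 0) = (M *m map_mx Im u) i 0.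
  rewrite !mxE (big_morph Im ImD (erefl (Im 0))); apply: eq_bigr => j _.
  by rewrite ImM !mxE /= mul0r add0r.
split=> [/eigenvalue_colP[u Mu u0]|[x [y [xy Mx My]]]].
  exists (map_mx Re u), (map_mx Im u); split.
  - apply: contraNT u0; rewrite negb_or !negbK => /andP[/eqP x0 /eqP y0].
    apply/eqP/colP => i; move/colP/(_ i): x0; move/colP/(_ i): y0.
    by rewrite !mxE => Ii Ri; exact: ReIm.
  - by apply/colP => i; rewrite -ReS Mu !mxE ReM.
  - by apply/colP => i; rewrite -ImS Mu !mxE ImM.
pose u : 'cV[C]_n := \col_i (Complex (x i 0) (y i 0)).
have uRe : map_mx Re u = x by apply/colP => i; rewrite !mxE.
have uIm : map_mx Im u = y by apply/colP => i; rewrite !mxE.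
apply/eigenvalue_colP; exists u.
  apply/colP => i; apply: ReIm; rewrite ?ReS ?ImS ?uRe ?uIm ?Mx ?My.
    by rewrite !mxE ReM.
  by rewrite !mxE ImM.
apply: contraTneq xy => u0; rewrite negb_or !negbK -uRe -uIm u0.
by apply/andP; split; apply/eqP/colP => i; rewrite !mxE.
Qed.

Lemma sqnormc_lt1 (z : C) :
  (`|z| < 1) = (complex.Re z ^+ 2 + complex.Im z ^+ 2 < 1).
Proof.
case: z => a b; rewrite normc_lt1 /=.
by rewrite -[ltRHS](@sqrtr1 R) ltr_sqrt.
Qed.

(** [qform X x + qform X y] is the Hermitian form of [X] at the complex vector with parts [x] and
    [y], which scales by the squared modulus of [z]; the cross terms cancel. *)
Lemma qform_eigenpair n (M X : 'M[R]_n) z x y : X^T = X -> eigenpair M z x y ->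
  qform X (M *m x) + qform X (M *m y) =
  (complex.Re z ^+ 2 + complex.Im z ^+ 2) * (qform X x + qform X y).
Proof.
move=> Xs [_ -> ->].
have scE a (Y : 'M[R]_1) : (a *: Y) 0 0 = a * Y 0 0 by rewrite mxE.
rewrite -scaleNr !qform_add // !qformZ -!scalemxAr ![(_ *: x)^T]linearZ /=.
by rewrite -!scalemxAl !scE; ring.
Qed.

Lemma schur_of_lyapunov n m (A : 'M[R]_n) (B : 'M[R]_(n, m)) (F Fs : 'M[R]_(m, n))
    (W : 'M[R]_m) (X Y : 'M[R]_n) :
  schur (A - B *m Fs) -> posdef W -> possemidef X -> possemidef Y ->
  X = (A - B *m F)^T *m X *m (A - B *m F) + (F - Fs)^T *m W *m (F - Fs) + Y ->
  schur (A - B *m F).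
Proof.
move=> Ss [Ws W0] [Xs X0] [Ys Y0] EX z /eigenvalue_eigenpair[x [y xyP]].
rewrite sqnormc_lt1 ltNge; apply/negP => z1.
have W0' v : 0 <= qform W v by exact: (posdefW (conj Ws W0)).2.
have expand v : qform X v = qform X ((A - B *m F) *m v)
    + qform W ((F - Fs) *m v) + qform Y v.
  by rewrite {1}EX !qformD !qform_congr.
have X00 : 0 <= qform X x + qform X y by rewrite addr_ge0 //; exact: X0.
have := qform_eigenpair Xs xyP; have Ex := expand x; have Ey := expand y.
set s := _ + _ ^+ 2 => Es; rewrite -/s in z1.
have sX : 0 <= (s - 1) * (qform X x + qform X y).
  by rewrite mulr_ge0 // subr_ge0.
have Yx : 0 <= qform Y x by exact: Y0.
have Yy : 0 <= qform Y y by exact: Y0.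
have Wx := W0' ((F - Fs) *m x); have Wy := W0' ((F - Fs) *m y).
have W_eq0 v : qform W v = 0 -> v = 0.
  by move=> Wv; apply/eqP; apply: contraTT isT => /W0; rewrite -/(qform W v) Wv ltxx.
(* Summing [Ex] and [Ey] and inserting [Es] writes 0 as [(s - 1)] times the form of [X] plus the [W]
   and [Y] terms. All are nonnegative, so each vanishes. *)
have Fx : (F - Fs) *m x = 0 by apply: W_eq0; lra.
have Fy : (F - Fs) *m y = 0 by apply: W_eq0; lra.
have cl v : (F - Fs) *m v = 0 -> (A - B *m Fs) *m v = (A - B *m F) *m v.
  move=> /eqP; rewrite mulmxBl subr_eq0 => /eqP Fv.
  by rewrite !mulmxBl -!mulmxA Fv.
have /Ss : eigenvalue (cplx (A - B *m Fs)) z.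
  apply/eigenvalue_eigenpair; exists x, y.
  by case: xyP => xy Mx My; split; rewrite ?cl.
by rewrite sqnormc_lt1 ltNge z1.
Qed.

End RealEigenvectors.

(** * The cost operator of a fixed gain and completion of the square *)

Section PolicyEvaluation.
Variables (R : realType) (n m : nat).
Variables (A : 'M[R]_n) (B : 'M[R]_(n, m)) (S : 'M[R]_n) (Rc : 'M[R]_m).
Hypothesis Rcs : Rc^T = Rc.

Definition closed_loop (F : 'M[R]_(m, n)) : 'M[R]_n := A - B *m F.

(** Bellman operator of the feedback [u = - F x] with state weight [S] and input weight [Rc]; policy
    evaluation asks for a fixed point. *)
Definition policy_cost (F : 'M[R]_(m, n)) (P : 'M[R]_n) : 'M[R]_n :=
  (closed_loop F)^T *m P *m closed_loop F + F^T *m Rc *m F + S.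

Definition control_weight (P : 'M[R]_n) : 'M[R]_m := Rc + B^T *m P *m B.

(* The first-order condition for [F] to minimize [policy_cost F P]. *)
Definition greedy (F : 'M[R]_(m, n)) (P : 'M[R]_n) : Prop :=
  control_weight P *m F = B^T *m P *m A.

Lemma control_weight_sym P : P^T = P -> (control_weight P)^T = control_weight P.
Proof.
by move=> Ps; rewrite /control_weight linearD /= !trmx_mul trmxK Ps Rcs mulmxA.
Qed.

(** Positivity of the weight, once known at the optimal cost, passes to every iterate above it and
    to their limit. *)
Lemma control_weight_le P1 P2 :
  posdef (control_weight P1) -> loewner_le P1 P2 -> posdef (control_weight P2).
Proof.
move=> W1 P12; have -> : control_weight P2 =
    control_weight P1 + B^T *m (P2 - P1) *m B.
  by rewrite mulmxBr mulmxBl /control_weight -addrA [_ + (_ - _)]addrC subrK.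
exact/posdefD/possemidef_congr.
Qed.

(** The cost is quadratic in [F] with Hessian [control_weight P], and the greedy equation and its
    transpose supply the linear terms. *)
Lemma policy_cost_square F Fs P : P^T = P -> greedy Fs P ->
  policy_cost F P = A^T *m P *m A - Fs^T *m control_weight P *m Fs
    + (F - Fs)^T *m control_weight P *m (F - Fs) + S.
Proof.
move=> Ps gFs; have Wsym := control_weight_sym Ps.
have gFsT : Fs^T *m control_weight P = A^T *m P *m B.
  by rewrite -[LHS]trmxK trmx_mul trmxK Wsym gFs !trmx_mul trmxK Ps mulmxA.
rewrite /policy_cost; congr (_ + S).
rewrite /closed_loop [(A - B *m F)^T]linearB [(F - Fs)^T]linearB /= trmx_mul.
rewrite !(mulmxBl, mulmxBr) gFsT -[F^T *m _ *m Fs]mulmxA gFs.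
rewrite /control_weight mulmxDr mulmxDl !mulmxA.
(* Once the products are abstracted, a purely additive identity remains and holds entry by entry. *)
move: (A^T *m P *m A) (F^T *m B^T *m P *m A) (A^T *m P *m B *m F)
  (F^T *m B^T *m P *m B *m F) (F^T *m Rc *m F) (A^T *m P *m B *m Fs)
  => t1 t2 t3 t4 t5 t6.
by apply/matrixP => i j; rewrite !mxE; ring.
Qed.

Lemma policy_cost_greedy F Fs P : P^T = P -> greedy Fs P ->
  policy_cost F P = policy_cost Fs P
    + (F - Fs)^T *m control_weight P *m (F - Fs).
Proof.
move=> Ps gFs; rewrite !(policy_cost_square _ Ps gFs) subrr.
by rewrite mulmx0 addr0 addrAC.
Qed.

(** The operator is affine in [P]; differences of costs thus become the expressions to which
    [schur_lyapunov] applies. *)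
Lemma policy_costB F P1 P2 : policy_cost F P1 - policy_cost F P2 =
  (closed_loop F)^T *m (P1 - P2) *m closed_loop F.
Proof.
rewrite /policy_cost [_ *m (P1 - P2)]mulmxBr mulmxBl.
move: (_ *m P1 *m _) (_ *m P2 *m _) (_ *m Rc *m _) => t1 t2 t3.
by apply/matrixP => i j; rewrite !mxE; ring.
Qed.

End PolicyEvaluation.

(** * Monotone convergence in the Loewner order *)

Section LoewnerLimits.
Variable R : realType.

Lemma qform_le n (X Y : 'M[R]_n) v : loewner_le X Y -> qform X v <= qform Y v.
Proof. by move=> [_ XY]; rewrite -subr_ge0 -qformB; exact: XY. Qed.

Lemma cvg_qform n (X_ : nat -> 'M[R]_n) (X : 'M[R]_n) v :
  X_ @ \oo --> X -> (fun k => qform (X_ k) v) @ \oo --> qform X v.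
Proof.
move=> XX.
have cstP p q (Y : 'M[R]_(p, q)) : (fun=> Y) @ \oo --> Y by exact: cvg_cst.
have := cvg_mulmx (cvg_mulmx (cstP _ _ v^T) XX) (cstP _ _ v).
by move=> /cvg_mxP /(_ 0 0).
Qed.

Lemma nonincreasing_mx_cvg n (X_ : nat -> 'M[R]_n) (L : 'M[R]_n) : L^T = L ->
  (forall k, loewner_le L (X_ k)) -> (forall k, loewner_le (X_ k.+1) (X_ k)) ->
  exists X, [/\ X^T = X, loewner_le L X & X_ @ \oo --> X].
Proof.
move=> Ls LX XS.
have Xs k : (X_ k)^T = X_ k.
  by have [] := LX k; rewrite linearB /= Ls => /addIr.
have cvgq v : cvg ((fun k => qform (X_ k) v) @ \oo).
  apply: nonincreasing_is_cvgn.
    by apply/nonincreasing_seqP => k; exact: qform_le.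
  by exists (qform L v) => _ [k _ <-]; exact: qform_le.
pose q v := limn (fun k => qform (X_ k) v).
(* Each form [qform (X_ k) v] is nonincreasing and bounded below by that of [L]; polarizing the
   limits [q] yields the candidate limit matrix. *)
pose X : 'M[R]_n := \matrix_(i, j) (2^-1 * (q (delta_mx i 0 + delta_mx j 0)
                  - q (delta_mx i 0) - q (delta_mx j 0))).
have XX : X_ @ \oo --> X.
  apply/cvg_mxP => i j; rewrite mxE.
  under eq_fun do rewrite (entry_qform _ _ (Xs _)).
  by apply: cvgMl_tmp; apply: cvgB; [apply: cvgB|]; exact: cvgq.
have XT : X^T = X.
  apply: (cvg_unique _ _ XX) => //.
  by have := cvg_trmx XX; under eq_fun do rewrite Xs.
exists X; split => //; split=> [|v]; first by rewrite linearB /= XT Ls.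
rewrite -/(qform (X - L) v) qformB subr_ge0 -(cvg_lim _ (cvg_qform XX)) //.
apply: limr_ge; first by apply/cvg_ex; eexists; exact: (cvg_qform XX).
by near=> k; exact: qform_le.
Unshelve. all: by end_near. Qed.

End LoewnerLimits.

(** * Stability, monotonicity and convergence of policy iteration *)

Section PolicyIteration.
Variables (R : realType) (n m : nat).
Variables (A : 'M[R]_n) (B : 'M[R]_(n, m)) (S : 'M[R]_n) (Rc : 'M[R]_m).
Hypothesis Rcs : Rc^T = Rc.
Local Notation cl := (closed_loop A B).
Local Notation cost := (policy_cost A B S Rc).
Local Notation W := (control_weight B Rc).

(** Since [Y] is a fixed point, the residual of [X] equals [D - (cl F)^T *m D *m cl F] with
    [D = X - Y]. *)
Lemma policy_cost_ge F X Y : schur (cl F) -> X^T = X -> Y^T = Y ->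
  Y = cost F Y -> possemidef (X - cost F X) -> loewner_le Y X.
Proof.
move=> Fs Xs Ys EY H; apply: (schur_lyapunov Fs).
  by rewrite linearB /= Xs Ys.
rewrite -(policy_costB _ _ S Rc) -EY.
by rewrite opprB addrA subrK.
Qed.

Lemma policy_cost_le F X Y : schur (cl F) -> X^T = X -> Y^T = Y ->
  Y = cost F Y -> possemidef (cost F X - X) -> loewner_le X Y.
Proof.
move=> Fs Xs Ys EY H; apply: (schur_lyapunov Fs).
  by rewrite linearB /= Xs Ys.
rewrite -(policy_costB _ _ S Rc) -EY.
by rewrite opprB addrC addrA subrK.
Qed.

Variables (P : 'M[R]_n) (Fs : 'M[R]_(m, n)).
Hypotheses (Psym : P^T = P) (PFs : greedy A B Rc Fs P) (Pcost : P = cost Fs P)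
  (Fs_schur : schur (cl Fs)) (WP : posdef (W P)).

(** Completing the square around [Fs] shows that [cost F P - P] is a square weighted by [W P]. *)
Lemma optimal_cost_le F X : schur (cl F) -> X^T = X -> X = cost F X ->
  loewner_le P X.
Proof.
move=> Fsch Xs EX; apply: (policy_cost_le Fsch) => //.
rewrite (policy_cost_greedy _ Rcs F Psym PFs) -Pcost addrC addrA addNr add0r.
exact/possemidef_congr/posdefW.
Qed.

(** Evaluating both [X] and [P] along [F'] expresses [X - P] as its image under the loop of [F']
    plus two squares: one in [F' - Fs] weighted by [W P], one in [F - F'] weighted by [W X]. *)
Lemma greedy_schur F F' X : X^T = X -> X = cost F X -> loewner_le P X ->
  greedy A B Rc F' X -> schur (cl F').
Proof.
move=> Xs EX PX gF'.
have WX := control_weight_le WP PX.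
apply: (schur_of_lyapunov (Y := (F - F')^T *m W X *m (F - F')) Fs_schur WP PX).
  exact/possemidef_congr/posdefW.
rewrite -/(cl F') -(policy_costB _ _ S Rc).
have := policy_cost_greedy S Rcs F' Psym PFs; rewrite -Pcost => ->.
rewrite [in LHS]EX (policy_cost_greedy S Rcs F Xs gF').
by rewrite opprD addrA subrK addrAC.
Qed.

(** Policy improvement: the old cost [X] exceeds [cost F' X] by a square weighted by [W X]. *)
Lemma greedy_cost_le F F' X Y : X^T = X -> X = cost F X -> loewner_le P X ->
  greedy A B Rc F' X -> Y^T = Y -> Y = cost F' Y -> loewner_le Y X.
Proof.
move=> Xs EX PX gF' Ys EY; have F'sch := greedy_schur Xs EX PX gF'.
apply: (policy_cost_ge F'sch) => //.
rewrite [X in X - _]EX (policy_cost_greedy S Rcs F Xs gF') addrC addrA addNr add0r.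
exact/possemidef_congr/posdefW/(control_weight_le WP).
Qed.

Variables (P_ : nat -> 'M[R]_n) (F_ : nat -> 'M[R]_(m, n)).
Hypotheses (P_sym : forall k, (P_ k)^T = P_ k)
  (P_cost : forall k, P_ k = cost (F_ k) (P_ k))
  (F_greedy : forall k, greedy A B Rc (F_ k.+1) (P_ k))
  (F0_schur : schur (cl (F_ 0%N))).

Lemma policy_iteration_schur k : schur (cl (F_ k)).
Proof.
elim: k => [|k Fk]; first exact: F0_schur.
have PPk := optimal_cost_le Fk (P_sym k) (P_cost k).
exact: (greedy_schur (P_sym k) (P_cost k) PPk (F_greedy k)).
Qed.

Lemma policy_iteration_ge k : loewner_le P (P_ k).
Proof. exact: (optimal_cost_le (@policy_iteration_schur k) (P_sym k) (P_cost k)). Qed.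

Lemma policy_iteration_nonincreasing k : loewner_le (P_ k.+1) (P_ k).
Proof.
exact: (greedy_cost_le (P_sym k) (P_cost k) (policy_iteration_ge k) (F_greedy k)
  (P_sym k.+1) (P_cost k.+1)).
Qed.

Lemma policy_iteration_cvg : P_ @ \oo --> P /\ F_ @ \oo --> Fs.
Proof.
have [L [Ls PL PcvgL]] := nonincreasing_mx_cvg Psym policy_iteration_ge
  policy_iteration_nonincreasing.
have WL := control_weight_le WP PL.
have W_ k := control_weight_le WP (policy_iteration_ge k).
have cstP p q (Y : 'M[R]_(p, q)) : (fun=> Y) @ \oo --> Y by exact: cvg_cst.
have BP p q (M : 'M[R]_(p, n)) (N : 'M[R]_(n, q)) :
    (fun k => M *m P_ k *m N) @ \oo --> M *m L *m N.
  exact: (cvg_mulmx (cvg_mulmx (cstP _ _ M) PcvgL) (cstP _ _ N)).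
have Wcvg : (fun k => W (P_ k)) @ \oo --> W L by apply: cvgD; [exact: cvg_cst|exact: BP].
pose F := invmx (W L) *m (B^T *m L *m A).
have gF : greedy A B Rc F L by rewrite /greedy mulKVmx // posdef_unitmx.
have Fcvg : F_ @ \oo --> F.
  (* Only the gains from index 1 on are greedy, [F_ 0] being given, so the limit is taken along the
     shifted sequence. *)
  rewrite -cvg_shiftS /=.
  have -> : (fun k => F_ k.+1) = (fun k => invmx (W (P_ k)) *m (B^T *m P_ k *m A)).
    by apply/funext => k; rewrite -F_greedy mulKmx // posdef_unitmx.
  apply: cvg_mulmx; last exact: BP.
  by apply: cvg_invmx => // [k|]; exact: posdef_unitmx.
have LF : L = cost F L.
  apply: (cvg_unique _ PcvgL) => //.
  have -> : P_ = (fun k => cost (F_ k) (P_ k)) by apply/funext.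
  have clcvg : (fun k => cl (F_ k)) @ \oo --> cl F.
    by apply: cvgB; [exact: cvg_cst|exact: (cvg_mulmx (cstP _ _ B) Fcvg)].
  apply: cvgD; last exact: cvg_cst.
  apply: cvgD.
    exact: (cvg_mulmx (cvg_mulmx (cvg_trmx clcvg) PcvgL) clcvg).
  exact: (cvg_mulmx (cvg_mulmx (cvg_trmx Fcvg) (cstP _ _ Rc)) Fcvg).
(* The comparison runs along [Fs], whose loop is Schur and whose cost is [P]; greediness of [F] at
   [L] makes [cost Fs L - L] a square. *)
have LP : loewner_le L P.
  apply: (policy_cost_le Fs_schur) => //.
  rewrite (policy_cost_greedy S Rcs Fs Ls gF) -LF addrC addrA addNr add0r.
  exact/possemidef_congr/posdefW.
have E := loewner_le_anti LP PL; rewrite E in gF PcvgL; split=> //.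
suff <- : F = Fs by [].
by rewrite -(mulKmx (posdef_unitmx WP) F) gF -PFs mulKmx // posdef_unitmx.
Qed.

End PolicyIteration.

(** * Absorbing the discount factor into the system matrices *)

Section Discounting.
Variables (R : realType) (n m : nat) (gamma : R).
Hypothesis gamma_ge0 : 0 <= gamma.
Variables (A : 'M[R]_n) (B : 'M[R]_(n, m)) (S : 'M[R]_n) (Rc : 'M[R]_m).
Local Notation s := (Num.sqrt gamma).

Lemma scaled_sandwich p q (M : 'M[R]_(n, p)) (N : 'M[R]_(n, q)) (P : 'M[R]_n) :
  (s *: M)^T *m P *m (s *: N) = gamma *: (M^T *m P *m N).
Proof.
by rewrite [(s *: M)^T]linearZ /= -!scalemxAl -scalemxAr scalerA -expr2 sqr_sqrtr.
Qed.

Lemma closed_loop_scaled F :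
  closed_loop (s *: A) (s *: B) F = s *: (A - B *m F).
Proof. by rewrite /closed_loop -scalemxAl scalerBr. Qed.

Lemma control_weight_scaled P :
  control_weight (s *: B) Rc P = weight gamma B Rc P.
Proof. by rewrite /control_weight scaled_sandwich. Qed.

Lemma policy_cost_scaled F P : policy_cost (s *: A) (s *: B) S Rc F P =
  gamma *: ((A - B *m F)^T *m P *m (A - B *m F)) + F^T *m Rc *m F + S.
Proof. by rewrite /policy_cost closed_loop_scaled scaled_sandwich. Qed.

Lemma riccati_gain_greedy P : weight gamma B Rc P \in unitmx ->
  greedy (s *: A) (s *: B) Rc (riccati_gain gamma A B Rc P) P.
Proof.
move=> Wu; rewrite /greedy control_weight_scaled scaled_sandwich /riccati_gain.
by rewrite -scalemxAr -!mulmxA mulKVmx.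
Qed.

(** At the Riccati gain the completed square vanishes, and the remaining term weighted by
    [control_weight] is the [gamma ^+ 2] term of the equation. *)
Lemma riccati_solution_cost P : Rc^T = Rc ->
  riccati_solution gamma A B S Rc P ->
  P = policy_cost (s *: A) (s *: B) S Rc (riccati_gain gamma A B Rc P) P.
Proof.
move=> Rcs [Ps Wu EP].
have gP := riccati_gain_greedy Wu.
rewrite (policy_cost_square S Rcs _ Ps gP) subrr mulmx0 addr0.
rewrite scaled_sandwich [in LHS]EP -[_ *m _ *m riccati_gain _ _ _ _ _]mulmxA gP.
congr (_ - _ + _); rewrite scaled_sandwich /riccati_gain [(gamma *: _)^T]linearZ /=.
rewrite -scalemxAl -scalemxAr scalerA -expr2 !trmx_mul trmx_inv trmxK Ps.
by rewrite -control_weight_scaled (control_weight_sym _ Rcs Ps) !mulmxA.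
Qed.

End Discounting.

(** * Positive definiteness of the weight at the stabilizing solution *)

Section Positivity.
Variables (R : realType) (n m : nat) (gamma : R).
Hypothesis gamma_ge0 : 0 <= gamma.
Variables (A : 'M[R]_n) (B : 'M[R]_(n, m)) (S : 'M[R]_n) (Rc : 'M[R]_m).
Local Notation s := (Num.sqrt gamma).
Local Notation cost := (policy_cost (s *: A) (s *: B) S Rc).

Lemma weight_posdef_psd F P : P^T = P -> posdef Rc -> possemidef S ->
  schur (closed_loop (s *: A) (s *: B) F) -> P = cost F P ->
  posdef (weight gamma B Rc P).
Proof.
move=> Ps Rc0 S0 Fsch EP; rewrite -control_weight_scaled //.
apply: posdefD => //; apply: possemidef_congr.
(* [P >= 0] is obtained by comparison with the problem whose weights [S] and [Rc] are zero, for
   which 0 is a fixed point. *)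
rewrite -[P]subr0.
apply: (policy_cost_ge (S := 0) (Rc := 0) Fsch) => //; rewrite ?trmx0 //.
  by rewrite /policy_cost !(mulmx0, mul0mx, addr0).
rewrite [X in X - _]EP /policy_cost mulmx0 mul0mx !addr0 -addrA.
rewrite [(_ *m P *m _) + _]addrC addrACA subrr addr0.
by apply: possemidefD => //; exact/possemidef_congr/posdefW.
Qed.

Lemma riccati_block_weight P : posdef (riccati_block gamma A B S Rc P) ->
  posdef (weight gamma B Rc P).
Proof.
move=> [bs b0]; split.
  by move: bs; rewrite tr_block_mx => /eq_block_mx[].
move=> v v0; have := b0 (col_mx 0 v).
rewrite tr_col_mx trmx0 mul_row_block mul_row_col !mul0mx mulmx0 !add0r; apply.
apply: contraNneq v0 => E.
by have [_ ->] := eq_col_mx (etrans E (esym (col_mx0 _ _ _ _))).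
Qed.

(** Congruence of the block matrix by the column of [1%:M] over [- F], that is, restriction to
    inputs [u = - F x], gives exactly this residual. *)
Lemma riccati_block_cost F P : P^T = P ->
  posdef (riccati_block gamma A B S Rc P) -> possemidef (cost F P - P).
Proof.
move=> Ps /posdefW b0.
have := possemidef_congr (col_mx 1%:M (- F)) b0.
rewrite tr_col_mx trmx1 linearN /= mul_row_block mul_row_col.
set L := (X in possemidef X -> _); suff -> : L = cost F P - P by [].
rewrite policy_cost_scaled // [(A - B *m F)^T]linearB /= trmx_mul {}/L.
rewrite mulNmx mulmxN !mul1mx !mulmx1 /weight.
rewrite !(mulmxDl, mulmxBl, mulNmx, mulmxDr, mulmxBr, mulmxN).
rewrite -!scalemxAr -!scalemxAl !mulmxA.
move: (A^T *m P *m A) (A^T *m P *m B *m F) (F^T *m B^T *m P *m A)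
  (F^T *m B^T *m P *m B *m F) (F^T *m Rc *m F) => t1 t2 t3 t4 t5.
by apply/matrixP => i j; rewrite !mxE; ring.
Qed.

(** By [riccati_block_cost], [Pt] lies below the cost of any stabilizing gain, in particular below
    [P], and the weight is monotone. *)
Lemma weight_posdef_block F P Pt : P^T = P -> Pt^T = Pt ->
  posdef (riccati_block gamma A B S Rc Pt) ->
  schur (closed_loop (s *: A) (s *: B) F) -> P = cost F P ->
  posdef (weight gamma B Rc P).
Proof.
move=> Ps Pts b0 Fsch EP; rewrite -control_weight_scaled //.
apply: (@control_weight_le _ _ _ _ _ Pt).
  by rewrite control_weight_scaled //; exact: riccati_block_weight.
exact: (policy_cost_le Fsch Pts Ps EP (riccati_block_cost F Pts b0)).
Qed.

End Positivity.

(** The sum factors as [(1%:M - Gam)^T *m Q *m (1%:M - Gam)]. *)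
Lemma Qshift_psd (R : realType) n (Q Gam : 'M[R]_n) :
  possemidef Q -> possemidef (Q + Qshift Q Gam).
Proof.
move=> Q0; have := possemidef_congr (1%:M - Gam) Q0.
set L := (X in possemidef X -> _); suff -> : L = Q + Qshift Q Gam by [].
rewrite {}/L [(1%:M - Gam)^T]linearB /= trmx1 !(mulmxBl, mulmxBr, mul1mx, mulmx1) /Qshift.
move: (Gam^T *m Q *m Gam) (Q *m Gam) (Gam^T *m Q) => t1 t2 t3.
by apply/matrixP => i j; rewrite !mxE; ring.
Qed.

Theorem theorem2 (R : realType) (d : measure_display)
    (Omega : measurableType d) (Pr : probability Omega R)
    (N n m q : nat) (hN : (0 < N)%N)
    (A G Q Gam : 'M[R]_n) (B : 'M[R]_(n, m)) (D : 'M[R]_(n, q))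
    (Rc : 'M[R]_m) (gamma sigma : R)
    (hQ : Q^T = Q) (hRc : Rc^T = Rc)
    (hgamma : 0 < gamma < 1)
    (* the multi-agent system *)
    (x : 'I_N -> nat -> Omega -> 'cV[R]_n)
    (u : 'I_N -> nat -> Omega -> 'cV[R]_m)
    (w : 'I_N -> nat -> Omega -> 'cV[R]_q)
    (hdyn : mean_field_dynamics A G B D x u w)
    (hw : white_noises Pr sigma w)
    (* Assumption 1 *)
    (h1 : initial_states Pr (fun i => x i 0%N) w)
    (* Assumption 2 *)
    (h2 : stabilizable gamma A B /\ stabilizable gamma (A + G) B)
    (* Assumption 3 or Assumption 4 *)
    (h34 :
      [/\ possemidef Q, posdef Rc,
          detectable (Num.sqrt gamma *: A) (psd_sqrt Q)
        & detectable (Num.sqrt gamma *: (A + G)) (psd_sqrt Q *m (1%:M - Gam))]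
      \/
      (exists Pt Pit : 'M[R]_n,
        [/\ Pt^T = Pt, Pit^T = Pit,
            posdef (riccati_block gamma A B Q Rc Pt)
          & posdef (riccati_block gamma (A + G) B (Q + Qshift Q Gam) Rc Pit)]))
    (P Pi : 'M[R]_n) (K Kbar : 'M[R]_(m, n))
    (hP : riccati_solution gamma A B Q Rc P)
    (hK : K = riccati_gain gamma A B Rc P)
    (hPstab : schur (Num.sqrt gamma *: (A - B *m K)))
    (hPi : riccati_solution gamma (A + G) B (Q + Qshift Q Gam) Rc Pi)
    (hKbar : Kbar = riccati_gain gamma (A + G) B Rc Pi - K)
    (hPistab : schur (Num.sqrt gamma *: (A + G - B *m K - B *m Kbar)))
    (Pi_ : nat -> 'M[R]_n) (Kbar_ : nat -> 'M[R]_(m, n))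
    (hK0 : schur (Num.sqrt gamma *: (A + G - B *m K - B *m Kbar_ 0%N)))
    (hPi_sym : forall k, (Pi_ k)^T = Pi_ k)
    (hPi_ : forall k, let Abar := A + G - B *m K - B *m Kbar_ k in
      Pi_ k = gamma *: (Abar^T *m Pi_ k *m Abar)
              + (K + Kbar_ k)^T *m Rc *m (K + Kbar_ k) + Q + Qshift Q Gam)
    (hunit : forall k, weight gamma B Rc (Pi_ k) \in unitmx)
    (hKbar_ : forall k,
      Kbar_ k.+1 = riccati_gain gamma (A + G) B Rc (Pi_ k) - K) :
  [/\ forall k, schur (Num.sqrt gamma *: (A + G - B *m K - B *m Kbar_ k)),
      forall k, loewner_le (Pi_ k.+1) (Pi_ k) /\ loewner_le Pi (Pi_ k.+1),
      Pi_ @ \oo --> Pi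
    & Kbar_ @ \oo --> Kbar].
Proof.
have /andP[/ltW g0 _] := hgamma.
have [Pis Wu _] := hPi.
set S := Q + Qshift Q Gam in hPi h34.
set Fs := riccati_gain gamma (A + G) B Rc Pi.
have FsK : K + Kbar = Fs by rewrite hKbar addrC subrK.
(* In the total gain [K + Kbar_ k] the offset [K] disappears, leaving plain policy iteration for the
   pair [(A + G, B)]. *)
pose F_ k := K + Kbar_ k.
have loopE Kb : closed_loop (Num.sqrt gamma *: (A + G)) (Num.sqrt gamma *: B) (K + Kb)
    = Num.sqrt gamma *: (A + G - B *m K - B *m Kb).
  by rewrite closed_loop_scaled mulmxDr opprD addrA.
have Fs_schur : schur (closed_loop (Num.sqrt gamma *: (A + G))
    (Num.sqrt gamma *: B) Fs) by rewrite -FsK loopE.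
have gFs := riccati_gain_greedy g0 (A + G) Wu.
have cFs := riccati_solution_cost g0 hRc hPi.
(* Either alternative assumption yields a lower bound on [Pi], by 0 or by [Pit], at which the weight
   is positive definite. *)
have WPi : posdef (weight gamma B Rc Pi).
  case: h34 => [[Q0 Rc0 _ _]|[_ [Pt [_ Pts _ b0]]]].
    exact: (weight_posdef_psd g0 Pis Rc0 (Qshift_psd _ Q0) Fs_schur cFs).
  exact: (weight_posdef_block g0 Pis Pts b0 Fs_schur cFs).
rewrite -(control_weight_scaled g0) in WPi.
have cost_k k : Pi_ k = policy_cost (Num.sqrt gamma *: (A + G))
    (Num.sqrt gamma *: B) S Rc (F_ k) (Pi_ k).
  rewrite policy_cost_scaled // /F_ /S [B *m (K + _)]mulmxDr [- (_ + _)]opprD.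
  by rewrite [A + G + _]addrA [_ + (Q + _)]addrA; exact: (hPi_ k).
have greedy_k k : greedy (Num.sqrt gamma *: (A + G)) (Num.sqrt gamma *: B) Rc
    (F_ k.+1) (Pi_ k).
  have -> : F_ k.+1 = riccati_gain gamma (A + G) B Rc (Pi_ k).
    by rewrite /F_ hKbar_ addrC subrK.
  exact: riccati_gain_greedy.
have F0_schur : schur (closed_loop (Num.sqrt gamma *: (A + G))
    (Num.sqrt gamma *: B) (F_ 0%N)) by rewrite loopE.
have Fsch := policy_iteration_schur hRc Pis gFs cFs Fs_schur WPi hPi_sym cost_k
  greedy_k F0_schur.
have [cvgPi cvgF] := policy_iteration_cvg hRc Pis gFs cFs Fs_schur WPi hPi_sym cost_k
  greedy_k F0_schur.
split.
- by move=> k; rewrite -loopE; exact: Fsch.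
- move=> k; split.
    exact: (policy_iteration_nonincreasing hRc Pis gFs cFs Fs_schur WPi hPi_sym cost_k
      greedy_k F0_schur).
  exact: (policy_iteration_ge hRc Pis gFs cFs Fs_schur WPi hPi_sym cost_k
      greedy_k F0_schur).
- exact: cvgPi.
- rewrite hKbar; have -> : Kbar_ = (fun k => F_ k - K).
    by apply/funext => k; rewrite /F_ addrC addKr.
  by apply: cvgB; [exact: cvgF|exact: cvg_cst].
Qed.
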